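(* Let $(\Sigma,\Lambda,z)$ be a compact discrete Riemann surface with discrete complex structure $(\rho_Q)_{Q\in F(\Lambda)}$. (i) If all numbers $\rho_Q$ are real, then there exists a polyhedral surface consisting of rhombi (with the combinatorics of $\Lambda$) such that its induced discrete complex structure is the one of $(\Sigma,\Lambda,z)$. (ii) If all numbers $\rho_Q$ but one are real and the remaining one is not real, then there exists no piecewise planar quad-surface with the combinatorics of $\Lambda$ such that its induced discrete complex structure coincides with the one of $(\Sigma,\Lambda,z)$.
   Context: A surface means a connected oriented surface without boundary. A bipartite quad-decomposition $\Lambda$ of a surface $\Sigma$ is a cellular decomposition of $\Sigma$ that is locally finite (a compact subset of $\Sigma$ contains only finitely many faces) and strongly regular (two different faces are either disjoint or share only one vertex or share only one edge), all of whose 2-cells are quadrilaterals and whose 1-skeleton is bipartite. $F(\Lambda)$ is the set of faces. A decomposition of the vertices into two independent sets (black and white vertices) is fixed. For $Q\in F(\Lambda)$ with vertices $b_-,w_-,b_+,w_+$ in counterclockwise order ($b_\pm$ black, $w_\pm$ white), a chart $z_Q$ of $Q$ is an orientation-preserving embedding of $Q$ onto a rectilinear quadrilateral in $\mathbb{C}$ without self-intersections such that the images of $b_-,w_-,b_+,w_+$ are the vertices of the quadrilateral. Its oriented ratio of diagonals defines $\rho_Q:=-i\,\frac{z_Q(w_+)-z_Q(w_-)}{z_Q(b_+)-z_Q(b_-)}$, which has positive real part. Two charts of $Q$ are compatible if they give the same $\rho_Q$. A discrete Riemann surface $(\Sigma,\Lambda,z)$ is a bipartite quad-decomposition $\Lambda$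 of a surface $\Sigma$ together with an atlas $z$, i.e. a collection of compatible charts $z_Q$ of all faces $Q\in F(\Lambda)$; the assignment $Q\mapsto\rho_Q$ is its discrete complex structure. It is compact if $\Sigma$ is compact. A polyhedral surface consists of Euclidean polygons glued together along common edges (isometrically). A piecewise planar quad-surface is a polyhedral surface all of whose polygons are planar quadrilaterals; if its combinatorics is that of $\Lambda$, then isometric orientation-preserving embeddings of its faces into $\mathbb{C}$ are charts and define its induced discrete complex structure. *)

(* Defs.v *)
From Stdlib Require Import Relations.Relation_Operators.
From mathcomp Require Import all_boot all_order all_algebra.
From mathcomp Require Import all_classical all_reals.
From mathcomp Require Import complex.

Set Implicit Arguments.
Unset Strict Implicit.
Unset Printing Implicit Defensive.

Import Order.TTheory GRing.Theory Num.Theory.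

Local Open Scope classical_set_scope.
Local Open Scope complex_scope.
Local Open Scope ring_scope.

(** A cellular decomposition into quadrilaterals of an oriented surface is
    encoded by its faces and the gluing of their sides. The vertices of a face
    [Q] are numbered counterclockwise by ['I_4] (with addition mod 4):
       [0], [1], [2], [3]  stand for  b_-, w_-, b_+, w_+,
    so black vertices have even numbers. The pair [(Q, k)] denotes both the
    corner of [Q] at its vertex [k] and the side of [Q] going
    counterclockwise from vertex [k] to vertex [k + 1]. *)

Section Gluing.
Variables (F : Type) (glue : F * 'I_4 -> F * 'I_4).
Implicit Types (c : F * 'I_4) (Q : F).

(* Glued sides run in opposite directions, hence the vertex [k] of [Q] is
   identified with the end point of the side [glue (Q, k)]; this moves from a
   corner to the next one, clockwise, around the same vertex of the surface. *)
Definition next_corner c : F * 'I_4 := ((glue c).1, (glue c).2 + 1).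

Definition same_vertex c c' : Prop := exists n, iter n next_corner c = c'.

(* Every vertex has finite degree. *)
Definition locally_finite : Prop :=
  forall c, exists2 n, (0 < n)%N & iter n next_corner c = c.

Definition adjacent Q Q' : Prop := exists k l, glue (Q, k) = (Q', l).

Definition face_connected : Prop :=
  inhabited F /\ forall Q Q', clos_refl_trans F adjacent Q Q'.

(* The closed faces are embedded (they are the domains of charts). *)
Definition regular_faces : Prop :=
  forall Q k l, same_vertex (Q, k) (Q, l) -> k = l.

Definition disjoint_faces Q Q' : Prop :=
  forall k l, ~ same_vertex (Q, k) (Q', l).

Definition share_only_vertex Q Q' : Prop :=
  [/\ ~ adjacent Q Q' &
      exists k l, forall k' l',
        same_vertex (Q, k') (Q', l') <-> (k' = k /\ l' = l)].

Definition share_only_edge Q Q' : Prop :=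
  exists k l,
    (forall k' l', glue (Q, k') = (Q', l') <-> (k' = k /\ l' = l)) /\
    (forall k' l', same_vertex (Q, k') (Q', l') <->
       (k' = k /\ l' = l + 1) \/ (k' = k + 1 /\ l' = l)).

Definition strongly_regular : Prop :=
  forall Q Q', Q <> Q' ->
    [\/ disjoint_faces Q Q', share_only_vertex Q Q' | share_only_edge Q Q'].

End Gluing.

(* [glue_color] says that a side directed from black to white is glued to one
   directed from white to black: this combines the bipartiteness of the
   1-skeleton with the orientability condition that glued sides carry opposite
   directions. It also forces [glue] to have no fixed point, so that the
   surface has no boundary. *)
Record quad_decomposition := QuadDecomposition {
  face : choiceType;
  glue : face * 'I_4 -> face * 'I_4;
  glueK : involutive glue;
  glue_color : forall c, odd (glue c).2 = ~~ odd c.2;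
  glue_connected : face_connected glue;
  glue_locally_finite : locally_finite glue;
  glue_regular : regular_faces glue;
  glue_strongly_regular : strongly_regular glue
}.

Definition compact_surface (L : quad_decomposition) : Prop :=
  finite_set [set: face L].

Section Quadrilaterals.
Variable R : realType.
Implicit Type z : 'I_4 -> R[i].

Definition segment (a b : R[i]) : set R[i] :=
  [set (1 - t)%:C * a + t%:C * b | t in [set t : R | 0 <= t <= 1]].

Definition side z (k : 'I_4) : set R[i] := segment (z k) (z (k + 1)).

Definition side_length z (k : 'I_4) : R[i] := `|z (k + 1) - z k|.

(* Two different sides meet at most in a common vertex of the closed polygon;
   as opposite sides are disjoint, the four vertices are distinct. *)
Definition non_self_intersecting z : Prop :=
  forall k l x, k != l -> side z k x -> side z l x ->
    (l = k + 1 /\ x = z l) \/ (k = l + 1 /\ x = z k).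

Definition signed_area z : R :=
  (\sum_(k < 4) complex.Im ((z k)^*%C * z (k + 1))) / 2.

(* [signed_area] is positive iff the vertices are in counterclockwise order. *)
Record quadrilateral := Quadrilateral {
  corner :> 'I_4 -> R[i];
  corner_simple : non_self_intersecting corner;
  corner_ccw : 0 < signed_area corner
}.

Definition rho z : R[i] := - 'i%C * ((z 3 - z 1) / (z 2 - z 0)).

Definition is_rhombus z : Prop := forall k l, side_length z k = side_length z l.

End Quadrilaterals.

(* A chart of a face is given by the quadrilateral onto which it embeds the
   face, with its vertices labelled by those of the face. *)
Record discrete_riemann_surface (R : realType) := DiscreteRiemannSurface {
  decomposition :> quad_decomposition;
  chart : face decomposition -> quadrilateral R
}.

Definition complex_structure (R : realType) (M : discrete_riemann_surface R)
  (Q : face M) : R[i] := rho (chart Q).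

(* The piecewise planar quad-surfaces with the combinatorics of [L]: planar
   quadrilaterals, one for each face, glued isometrically along their sides. *)
Record planar_quad_surface (R : realType) (L : quad_decomposition) :=
  PlanarQuadSurface {
  polygon : face L -> quadrilateral R;
  polygon_isometric : forall Q k Q' k', glue (Q, k) = (Q', k') ->
    side_length (polygon Q) k = side_length (polygon Q') k'
}.

Definition rhombic (R : realType) (L : quad_decomposition)
  (S : planar_quad_surface R L) : Prop := forall Q, is_rhombus (polygon S Q).

(* The faces of [S], isometrically embedded in the plane, are its charts. *)
Definition induced (R : realType) (L : quad_decomposition)
  (S : planar_quad_surface R L) : discrete_riemann_surface R :=
  DiscreteRiemannSurface (polygon S).

(* Main.v *)
(** Twice the scalar product of the diagonals of a quadrilateral is minus the
    alternating sum of its squared side lengths, and [rho] is real iff this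
    scalar product vanishes.
    (i) A real [rho] is positive because the chart is positively oriented; the
    rhombus with side length 1 and ratio of diagonals [rho] realizes it, and all
    these rhombi fit together.
    (ii) In a closed quad-surface the alternating sums over all faces add up to
    zero, since glued sides have equal lengths and opposite signs. So it cannot
    happen that exactly one face has non-orthogonal diagonals. *)

Require Import Defs.
From mathcomp Require Import all_boot all_order all_algebra.
From mathcomp Require Import all_classical all_reals.
From mathcomp Require Import complex.
From mathcomp Require Import ring lra.

Set Implicit Arguments.
Unset Strict Implicit.
Unset Printing Implicit Defensive.

Import Order.TTheory GRing.Theory Num.Theory.

Local Open Scope ring_scope.

Lemma ord4P (k : 'I_4) : [\/ k = 0, k = 1, k = 2 | k = 3].
Proof.
by case: k => [[|[|[|[|//]]]] ltk]; [constructor 1 | constructor 2 | constructor 3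
  | constructor 4]; apply/val_inj.
Qed.

Lemma succ_ord4 : ((((0 + 1)%R = 1%R :> 'I_4) * ((1 + 1)%R = 2%R :> 'I_4)) *
  (((2 + 1)%R = 3%R :> 'I_4) * ((3 + 1)%R = 0%R :> 'I_4)))%type.
Proof. by do !split; apply/val_inj. Qed.

Lemma big_ord4 (V : nmodType) (f : 'I_4 -> V) :
  \sum_k f k = f 0 + f 1 + f 2 + f 3.
Proof.
rewrite !big_ord_recl big_ord0 addr0 !addrA.
by do !congr (_ + _); congr f; apply/val_inj.
Qed.

Section Quadrilaterals.
Variable R : realType.
Implicit Type z : 'I_4 -> R[i].

Definition diag_dot z : R :=
  complex.Re (z 2 - z 0) * complex.Re (z 3 - z 1) +
  complex.Im (z 2 - z 0) * complex.Im (z 3 - z 1).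

Definition sqr_side z (k : 'I_4) : R :=
  complex.Re (z (k + 1) - z k) ^+ 2 + complex.Im (z (k + 1) - z k) ^+ 2.

Lemma side_lengthE z k : side_length z k = (Num.sqrt (sqr_side z k))%:C%C.
Proof. exact: normc_def. Qed.

Lemma eq_sqr_side z z' k k' :
  side_length z k = side_length z' k' -> sqr_side z k = sqr_side z' k'.
Proof.
rewrite !side_lengthE => -[/eqP]; rewrite /sqr_side.
by rewrite eqr_sqrt ?addr_ge0 ?sqr_ge0// => /eqP.
Qed.

Lemma alternating_sqr_side z :
  \sum_(k < 4) (-1) ^+ k * sqr_side z k = - (2 * diag_dot z).
Proof.
rewrite big_ord4 /sqr_side /diag_dot !succ_ord4.
case: (z 0) (z 1) (z 2) (z 3) => [a a'] [b b'] [c c'] [d d'] /=.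
ring.
Qed.

(** The shoelace sum depends only on the diagonals; hence a positive area forces both of them to be
    nonzero. *)
Lemma signed_area_diag z : signed_area z =
  (complex.Re (z 2 - z 0) * complex.Im (z 3 - z 1) -
   complex.Im (z 2 - z 0) * complex.Re (z 3 - z 1)) / 2.
Proof.
rewrite /signed_area big_ord4 !succ_ord4.
case: (z 0) (z 1) (z 2) (z 3) => [a a'] [b b'] [c c'] [d d'] /=.
by congr (_ / 2); ring.
Qed.

(** Multiply by the conjugate of the denominator: the factor [- 'i] turns the cross product of the
    diagonals into the real part and minus their scalar product into the imaginary part. *)
Lemma rhoE z :
  let n := complex.Re (z 2 - z 0) ^+ 2 + complex.Im (z 2 - z 0) ^+ 2 in
  rho z = Complex (2 * signed_area z / n) (- (diag_dot z / n)).
Proof.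
rewrite signed_area_diag /rho /diag_dot.
case: (z 2 - z 0) (z 3 - z 1) => [a a'] [b b'] /=.
by apply/eqP; rewrite eq_complex /=; apply/andP; split; apply/eqP;
  rewrite ?(mulrCA 2) ?divff ?pnatr_eq0 ?mulr1//; ring.
Qed.

(* If [z 0 = z 2] then [rho z = 0] by the convention [x / 0 = 0], so that no
   nondegeneracy is required. *)
Lemma rho_real z : (rho z \is Num.real) = (diag_dot z == 0).
Proof.
rewrite rhoE complex_real oppr_eq0 mulf_eq0 invr_eq0 orb_idr //.
rewrite paddr_eq0 ?sqr_ge0// !sqrf_eq0 => /andP[/eqP b0 /eqP b0'].
by rewrite /diag_dot b0 b0' !mul0r addr0.
Qed.

Lemma rho_real_gt0 (q : quadrilateral R) : rho q \is Num.real ->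
  exists2 r : R, 0 < r & rho q = r%:C%C.
Proof.
rewrite rho_real => /eqP dot0; exists (complex.Re (rho q)); last first.
  by rewrite rhoE dot0 mul0r oppr0.
have area_gt0 := corner_ccw q.
rewrite rhoE /=; apply: divr_gt0; first exact: mulr_gt0.
rewrite lt_def addr_ge0 ?sqr_ge0// andbT.
(* A vanishing black diagonal would make the area zero. *)
apply/eqP => /eqP; rewrite paddr_eq0 ?sqr_ge0// !sqrf_eq0.
move=> /andP[/eqP b0 /eqP b0']; move: area_gt0.
by rewrite signed_area_diag b0 b0' !mul0r subr0 mul0r ltxx.
Qed.

Section Rhombus.
Variables p q : R.
Hypotheses (p_gt0 : 0 < p) (q_gt0 : 0 < q).

Definition rhombus_corner (k : 'I_4) : R[i] :=
  nth 0 [:: Complex (- p) 0; Complex 0 (- q); Complex p 0; Complex 0 q] k.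

Lemma rhombus_simple : non_self_intersecting rhombus_corner.
Proof.
move=> k l x neq_kl [s /= /andP[s0 s1] <-] [t /= /andP[t0 t1]].
(* The products of [s] and [t] with [p] and [q] are the atoms in which comparing coordinates becomes
   linear. *)
have sp0 := mulr_ge0 s0 (ltW p_gt0); have sq0 := mulr_ge0 s0 (ltW q_gt0).
have tp0 := mulr_ge0 t0 (ltW p_gt0); have tq0 := mulr_ge0 t0 (ltW q_gt0).
have sp1 := ler_wpM2r (ltW p_gt0) s1; have sq1 := ler_wpM2r (ltW q_gt0) s1.
have tp1 := ler_wpM2r (ltW p_gt0) t1; have tq1 := ler_wpM2r (ltW q_gt0) t1.
have p_neq0 := lt0r_neq0 p_gt0; have q_neq0 := lt0r_neq0 q_gt0.
case: (ord4P k) (ord4P l) neq_kl => -> [] -> //;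
  rewrite ?succ_ord4 /rhombus_corner /= => _ [ex ey];
  (* Neighbouring sides can only meet at their common vertex, an end of side [k]. For opposite sides
     the equations are contradictory and yield any value of [s]. *)
  have [s_eq|s_eq] : s = 0 \/ s = 1 by first
    [ left; apply: (mulIf p_neq0) => /=; lra | left; apply: (mulIf q_neq0) => /=; lra
    | right; apply: (mulIf p_neq0) => /=; lra | right; apply: (mulIf q_neq0) => /=; lra ].
all: subst s; rewrite ?subr0 ?subrr ?rmorph0 ?rmorph1 ?mul0r ?mul1r ?add0r ?addr0.
all: by [left | right | exfalso; lra].
Qed.

Lemma rhombus_ccw : 0 < signed_area rhombus_corner.
Proof.
rewrite signed_area_diag /rhombus_corner /=.
have := mulr_gt0 p_gt0 q_gt0; lra.
Qed.

Definition rhombus := Quadrilateral rhombus_simple rhombus_ccw.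

Lemma rhombus_side_length k :
  side_length rhombus k = (Num.sqrt (p ^+ 2 + q ^+ 2))%:C%C.
Proof.
rewrite side_lengthE /sqr_side; congr ((Num.sqrt _)%:C%C).
by case: (ord4P k) => ->; rewrite succ_ord4 /=; ring.
Qed.

Lemma rho_rhombus : rho rhombus = (q / p)%:C%C.
Proof.
have p_neq0 := lt0r_neq0 p_gt0.
rewrite rhoE signed_area_diag /diag_dot /rhombus_corner /=.
have pp_neq0 : p - - p != 0 by rewrite opprK lt0r_neq0 ?addr_gt0.
by congr Complex; field; rewrite ?p_neq0 ?pp_neq0.
Qed.

End Rhombus.

(** Half-diagonals [1 / s] and [r / s] have ratio [r], and Pythagoras gives side 1 when
    [s ^ 2 = 1 + r ^ 2]. The common side length lets such rhombi be glued along any sides. *)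
Lemma exists_unit_rhombus (r : R) : 0 < r ->
  exists2 z : quadrilateral R, forall k, side_length z k = 1 & rho z = r%:C%C.
Proof.
move=> r_gt0; set s := Num.sqrt (1 + r ^+ 2).
have s2_gt0 : 0 < 1 + r ^+ 2 by rewrite ltr_wpDr ?sqr_ge0.
have s_gt0 : 0 < s by rewrite sqrtr_gt0.
have p_gt0 : 0 < s^-1 by rewrite invr_gt0.
have q_gt0 : 0 < r / s by rewrite divr_gt0.
exists (rhombus p_gt0 q_gt0) => [k|].
  rewrite rhombus_side_length.
  suff -> : s^-1 ^+ 2 + (r / s) ^+ 2 = 1 by rewrite sqrtr1.
  have -> : s^-1 ^+ 2 + (r / s) ^+ 2 = (1 + r ^+ 2) / s ^+ 2.
    by field; rewrite lt0r_neq0.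
  by rewrite sqr_sqrtr ?ltW// divff ?lt0r_neq0.
by rewrite rho_rhombus invrK mulfVK ?lt0r_neq0.
Qed.

End Quadrilaterals.

Lemma sum_diag_dot (R : realType) (L : quad_decomposition)
    (S : planar_quad_surface R L) (s : seq (face L)) :
  uniq s -> (forall Q, Q \in s) -> \sum_(Q <- s) diag_dot (polygon S Q) = 0.
Proof.
move=> uniq_s mem_s.
pose f (c : face L * 'I_4) : R := (-1) ^+ c.2 * sqr_side (polygon S c.1) c.2.
pose t := [seq (Q, k) | Q <- s, k <- enum 'I_4].
have uniq_t : uniq t by rewrite allpairs_uniq ?enum_uniq// => -[? ?] [? ?].
have mem_t c : c \in t.
  by case: c => Q k; apply/allpairsP; exists (Q, k); rewrite mem_s mem_enum.
have f_glue c : f (Defs.glue c) = - f c.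
  case: c => Q k; case eq_c : (Defs.glue (Q, k)) => [Q' k'].
  rewrite /f /= (eq_sqr_side (polygon_isometric S eq_c)) -mulNr.
  (* Glued sides have indices of opposite parity, which flips the sign. *)
  have := glue_color (Q, k); rewrite eq_c /= => odd_k'.
  by rewrite -signr_odd odd_k' signrN signr_odd.
have sum_f : \sum_(c <- t) f c = 0.
  (* Reindexing along the involution [glue], a permutation of all sides, turns the sum into its
     negative. *)
  suff sumN : \sum_(c <- t) f c = - \sum_(c <- t) f c by lra.
  rewrite [LHS](perm_big (map (@Defs.glue L) t)) /=; last first.
    apply: uniq_perm => //; first by rewrite map_inj_uniq//; exact/can_inj/glueK.
    by move=> c; rewrite mem_t; apply/esym/mapP; exists (Defs.glue c); rewrite ?glueK.
  by rewrite big_map -sumrN; apply: eq_bigr.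
suff : \sum_(c <- t) f c = - (2 * \sum_(Q <- s) diag_dot (polygon S Q)) by lra.
rewrite big_allpairs mulr_sumr -sumrN; apply: eq_bigr => Q _.
by rewrite -alternating_sqr_side big_enum.
Qed.

Theorem theorem2p2 (R : realType) (M : discrete_riemann_surface R)
    (hM : compact_surface M) :
  ((forall Q : face M, complex_structure Q \is Num.real) ->
   exists S : planar_quad_surface R M,
     rhombic S /\
     forall Q : face M,
       @complex_structure R (induced S) Q = complex_structure Q) /\
  (forall Q0 : face M,
     complex_structure Q0 \isn't Num.real ->
     (forall Q : face M, Q != Q0 -> complex_structure Q \is Num.real) ->
     ~ exists S : planar_quad_surface R M,
         forall Q : face M,
           @complex_structure R (induced S) Q = complex_structure Q).
Proof.
split=> [rho_realM|Q0 rhoQ0 rhoQ [S rhoS]].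
  have rhombusP (Q : face M) : {z : quadrilateral R |
      (forall k, side_length z k = 1) /\ rho z = complex_structure Q}.
    (* Choice fixes one rhombus per face, which provides the function [polygon]. *)
    apply: cid; have [r r_gt0 rhoQ] := rho_real_gt0 (rho_realM Q).
    by have [z ? ?] := exists_unit_rhombus r_gt0; exists z; rewrite /complex_structure rhoQ.
  have iso (Q : face M) k (Q' : face M) k' : Defs.glue (Q, k) = (Q', k') ->
      side_length (sval (rhombusP Q)) k = side_length (sval (rhombusP Q')) k'.
    by rewrite !(svalP (rhombusP _)).1.
  exists (PlanarQuadSurface iso); split=> [Q k l|Q].
    by rewrite !(svalP (rhombusP _)).1.
  exact: (svalP (rhombusP Q)).2.
have [s0 s0E] := (finite_seqP _).1 hM.
have mem_s (Q : face M) : Q \in undup s0.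
  by rewrite mem_undup; have : [set: face M]%classic Q by []; rewrite s0E.
have := sum_diag_dot S (undup_uniq s0) mem_s.
(* All other faces contribute zero, so [diag_dot] vanishes at [Q0] too and [rho] is real there. *)
rewrite (bigD1_seq Q0) ?undup_uniq//= big1 => [|Q neqQ].
  rewrite addr0 => dot0; move: rhoQ0.
  by rewrite -rhoS /complex_structure rho_real /= dot0 eqxx.
by apply/eqP; rewrite -rho_real; have := rhoQ Q neqQ; rewrite -rhoS.
Qed.
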